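(* Let $\tau=k\tau_2\cdots\tau_k\in S_k$ (i.e., $\tau_1=k$). Let $0\leq\alpha_1<\alpha_2\leq 1$ and let $I_n=[a_n,b_n]$ where $a_n/n\to\alpha_1$ and $b_n/n\to\alpha_2$. For every $\delta$ with $0<\delta<\frac{\alpha_2-\alpha_1}{L(\tau)}$, $$\limsup_{n\to\infty}|S_n(\tau;\mathrm{LR}_n[I_n]<\delta n)|^{1/n}<L(\tau).$$
   Context: $S_n(\tau)$ is the set of permutations of $[n]$ avoiding $\tau$, and $L(\tau)=\lim_{n\to\infty}|S_n(\tau)|^{1/n}$ (which exists and is finite). A left-to-right maximum of $\sigma$ is an entry $\sigma_i$ with $\sigma_i>\sigma_j$ for all $j<i$. For an interval $I$, $S_n(\tau;\mathrm{LR}_n[I]<\delta n)$ is the set of $\sigma\in S_n(\tau)$ having fewer than $\delta n$ left-to-right maxima $\sigma_i$ with $\sigma_i\in I$. *)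

(* Defs.v *)
From HB Require Import structures.
From mathcomp Require Import all_boot all_order all_algebra perm.
From mathcomp Require Import mathcomp_extra boolp classical_sets functions.
From mathcomp Require Import reals ereal topology normedtype sequences exp.

Set Implicit Arguments.
Unset Strict Implicit.
Unset Printing Implicit Defensive.

Import Order.TTheory GRing.Theory Num.Theory.
Import numFieldNormedType.Exports.

Local Open Scope ring_scope.
Local Open Scope classical_set_scope.

(* Permutations of [n] = {1, ..., n} are elements of 'S_n: positions and values
   are shifted down by one, so the entry sigma_(i+1) is (sigma i).+1. *)

Definition contains (n k : nat) (sigma : 'S_n) (tau : 'S_k) : bool :=
  [exists f : {ffun 'I_k -> 'I_n},
    [forall a : 'I_k, forall b : 'I_k, (a < b)%N ==> (f a < f b)%N] &&
    [forall a : 'I_k, forall b : 'I_k, (sigma (f a) < sigma (f b))%N == (tau a < tau b)%N]].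

Definition avoiders (n k : nat) (tau : 'S_k) : {set 'S_n} :=
  [set sigma : 'S_n | ~~ contains sigma tau]%SET.

Definition lr_max (n : nat) (sigma : 'S_n) (i : 'I_n) : bool :=
  [forall j : 'I_n, (j < i)%N ==> (sigma j < sigma i)%N].

Definition lr_count (R : realType) (n : nat) (sigma : 'S_n) (I : interval R) : nat :=
  #|[set i : 'I_n | lr_max sigma i && ((sigma i).+1%:R \in I)]%SET|.

Definition avoiders_lr_lt (R : realType) (n k : nat) (tau : 'S_k)
    (I : interval R) (t : R) : {set 'S_n} :=
  [set sigma in avoiders n tau | (lr_count sigma I)%:R < t]%SET.

Definition nth_root_card (R : realType) (n : nat) (A : {set 'S_n}) : R :=
  #|A|%:R `^ n%:R^-1.

Definition growth_rate (R : realType) (k : nat) (tau : 'S_k) : R :=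
  lim (nth_root_card R (avoiders n tau) @[n --> \oo]).

(* Main.v *)
Require Import Defs.
From mathcomp Require Import all_boot all_order all_algebra perm.
From mathcomp Require Import classical_sets reals ereal topology normedtype sequences.
From mathcomp Require Import boolp exp zify ring lra.
Import Order.TTheory GRing.Theory Num.Theory.
Import numFieldNormedType.Exports.
Local Open Scope ring_scope.
Local Open Scope classical_set_scope.

(** Let s avoid tau and let v be a value of s. Inserting a new entry just below v, right
    before the first entry that is at least v, creates a left-to-right maximum and no
    occurrence of tau. Marking the inserted entry makes the operation injective, so if
    A(n, m, g) counts the avoiders of length n with at most m left-to-right maxima in a
    given window of g values, then g A(n, m, g) <= (m + 1) A(n + 1, m + 1, g + 1).
    Iterating j = n / q times, with m ~ delta n and g ~ (alpha2 - alpha1) n, gives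
    A(n, m, g) rho^j <= |S_(n + j)(tau)| for some rho > L(tau), as soon as q is large.
    Since |S_N(tau)| grows like L(tau)^N, A(n, m, g) is exponentially smaller than
    L(tau)^n. *)

(** * Insertion of a left-to-right maximum *)

Definition first_ge {n : nat} (s : 'S_n) (v : 'I_n) : 'I_n :=
  [arg min_(i < (s^-1)%g v | (v <= s i)%N) (i : nat)].

Definition insert_pos {n : nat} (s : 'S_n) (v : 'I_n) : 'I_n.+1 :=
  widen_ord (leqnSn n) (first_ge s v).

(** [lift_perm] raises the values from [v] upwards by one, so the new entry has value [v] and the
    old entry [v] becomes [v + 1]. *)
Definition insert_max {n : nat} (s : 'S_n) (v : 'I_n) : 'S_n.+1 :=
  lift_perm (insert_pos s v) (widen_ord (leqnSn n) v) s.

Definition lr_in {n : nat} (s : 'S_n) (p g : nat) : {set 'I_n} :=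
  [set i : 'I_n | lr_max s i && (p <= s i < p + g)%N]%SET.

Definition avoiders_lr_le (n : nat) {k : nat} (tau : 'S_k) (p g m : nat) : {set 'S_n} :=
  [set s in avoiders n tau | (#|lr_in s p g| <= m)%N]%SET.

Lemma first_geP {n : nat} (s : 'S_n) (v : 'I_n) :
  (v <= s (first_ge s v))%N /\ forall i : 'I_n, (i < first_ge s v)%N -> (s i < v)%N.
Proof.
rewrite /first_ge; case: arg_minnP => [|i vi imin]; first by rewrite permKV.
split=> // j ji; rewrite ltnNge; apply/negP => /imin; lia.
Qed.

Lemma lr_max_insert {n : nat} (s : 'S_n) (v : 'I_n) :
  lr_max (insert_max s v) (insert_pos s v).
Proof.
have [_ H] := first_geP s v.
apply/forallP => j; apply/implyP; rewrite /insert_max lift_perm_id.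
case: (unliftP (insert_pos s v) j) => [j'|] ->; last by rewrite ltnn.
rewrite lift_perm_lift /= /bump.
move=> j'q; have j'p : (j' < first_ge s v)%N by move: j'q; case: leqP => /=; lia.
by have := H _ j'p; case: leqP => /=; lia.
Qed.

(** Deleting an entry keeps the relative order of the others. Hence an insertion creates no
    left-to-right maximum besides possibly the new entry. *)
Lemma lr_max_lift {n : nat} (s : 'S_n) (p v : 'I_n.+1) (i : 'I_n) :
  lr_max (lift_perm p v s) (lift p i) -> lr_max s i.
Proof.
move=> /forallP H; apply/forallP => j; apply/implyP => ji.
have := H (lift p j); rewrite !lift_perm_lift /= /bump.
case: (leqP p j); case: (leqP p i); case: (leqP v (s j)); case: (leqP v (s i)) => /=; lia.
Qed.

(* A left-to-right maximum of [insert_max s v] can only play the initial, maximal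
   letter of [tau]; the entry right after the inserted one exceeds it, so it can
   play that letter in its place. *)
Lemma avoiders_insert {n k : nat} (tau : 'S_k.+1) (s : 'S_n) (v : 'I_n) :
  tau ord0 = ord_max ->
  s \in avoiders n tau -> insert_max s v \in avoiders n.+1 tau.
Proof.
move=> tau0; rewrite !inE; apply: contra => /existsP[f /andP[/forallP fmon /forallP fval]].
have {}fmon (a b : 'I_k.+1) : (a < b)%N -> (f a < f b)%N.
  by move=> ab; have /forallP /(_ b) /implyP := fmon a; exact.
have {}fval (a b : 'I_k.+1) : (insert_max s v (f a) < insert_max s v (f b))%N = (tau a < tau b)%N.
  by have /forallP /(_ b) /eqP := fval a.
have taumax (a : 'I_k.+1) : a != ord0 -> (tau a < tau ord0)%N.
  move=> a0; rewrite tau0 /= ltn_neqAle -ltnS ltn_ord andbT.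
  apply: contra a0 => /eqP ta; apply/eqP/(@perm_inj _ tau); rewrite tau0.
  exact/val_inj.
have [vM _] := first_geP s v.
pose p := insert_pos s v.
pose f' : {ffun 'I_k.+1 -> 'I_n} :=
  [ffun a => if unlift p (f a) is Some j then j else first_ge s v].
(* In a later role, the left-to-right maximum at [p] would exceed the entry playing the largest
   letter [tau ord0]. *)
have pE a : f a = p -> a = ord0.
  move=> fp; apply/eqP; apply: contraT => a0.
  have lt0a : (0 < a)%N by rewrite lt0n.
  have /forallP/(_ (f ord0))/implyP := lr_max_insert s v.
  rewrite -/p -fp => /(_ (fmon ord0 a lt0a)).
  by rewrite fval => /ltn_trans/(_ (taumax _ a0)); rewrite ltnn.
have f'P a : f a = lift p (f' a) \/ [/\ a = ord0, f a = p & f' a = first_ge s v].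
  rewrite ffunE; case: unliftP => [j|] H; first by left.
  by right; split=> //; exact: pE.
(* The remaining letters lie right of the inserted entry and below it, hence below [v]; the entry at
   [first_ge s v] is at least [v], so they come strictly after it. *)
have f'0 b : f ord0 = p -> b != ord0 ->
    [/\ f b = lift p (f' b), (first_ge s v < f' b)%N & (s (f' b) < v)%N].
  move=> f0 b0; have [fb|[b0' _ _]] := f'P b; last by rewrite b0' eqxx in b0.
  have lt0b : (0 < b)%N by rewrite lt0n.
  have fb1 : (first_ge s v <= f' b)%N.
    have := fmon ord0 b lt0b; rewrite f0 fb /= /bump.
    by case: leqP => //=; lia.
  have fb2 : (s (f' b) < v)%N.
    have := fval b ord0; rewrite (taumax _ b0) f0 fb lift_perm_id lift_perm_lift /= /bump.
    by case: leqP => //=; lia.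
  split=> //; rewrite ltn_neqAle fb1 andbT; apply/eqP => E.
  by move: fb2; rewrite -(val_inj E) ltnNge vM.
have lift_lt (q : 'I_n.+1) (i j : 'I_n) : (lift q i < lift q j)%N = (i < j)%N.
  by rewrite /= /bump; case: (leqP q i); case: (leqP q j) => /=; lia.
apply/existsP; exists f'; apply/andP; split; apply/forallP => a; apply/forallP => b.
  apply/implyP => ab; have := fmon _ _ ab.
  have b0 : b != ord0 by apply: contraTneq ab => ->; rewrite ltn0.
  have [fa|[a0 fa f'a]] := f'P a; last first.
    by rewrite f'a; subst a; have [] := f'0 b fa b0.
  have [fb|[b0']] := f'P b; last by rewrite b0' eqxx in b0.
  by rewrite fa fb lift_lt.
rewrite -fval; have [fa|[a0 fa f'a]] := f'P a; last first.
  subst a; have [->|b0] := eqVneq b ord0; first by rewrite !ltnn.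
  have [_ _ sb] := f'0 b fa b0.
  rewrite fval f'a [(tau _ < _)%N]ltnNge (ltnW (taumax b b0)) ltnNge.
  by rewrite (leq_trans (ltnW sb) vM).
have [fb|[b0 fb f'b]] := f'P b; first by rewrite fa fb !lift_perm_lift lift_lt.
subst b; have [->|a0] := eqVneq a ord0; first by rewrite !ltnn.
have [_ _ sa] := f'0 a fb a0.
by rewrite fval taumax // f'b (leq_trans sa vM).
Qed.

(** As [v] lies in the old window, values of the longer window, other than the inserted one, come
    from values of the old window. *)
Lemma card_lr_in_insert {n : nat} (s : 'S_n) (v : 'I_n) (p g : nat) :
  (p <= v < p + g)%N -> (#|lr_in (insert_max s v) p g.+1| <= #|lr_in s p g|.+1)%N.
Proof.
move=> vpg; set q := insert_pos s v.
have : lr_in (insert_max s v) p g.+1 \subset (q |: lift q @: lr_in s p g)%SET.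
  apply/fintype.subsetP => i; rewrite !inE => /andP[lri ri].
  move: lri ri; case: (unliftP q i) => [j|] ->; last by rewrite eqxx.
  rewrite {1}/insert_max => /lr_max_lift lrj.
  rewrite lift_perm_lift /= => rj.
  apply/orP; right; apply: imset_f; rewrite inE lrj /=.
  by move: rj; rewrite /bump /=; case: (leqP v (s j)) => /=; lia.
move/subset_leq_card/leq_trans; apply.
apply: leq_trans (leq_card_setU _ _) _; rewrite cards1 add1n ltnS.
exact: leq_imset_card.
Qed.

(** * Counting by repeated insertion *)

Lemma avoiders_lr_le_step {n k : nat} (tau : 'S_k.+1) (p g m : nat) :
  tau ord0 = ord_max -> (p + g <= n)%N ->
  (#|avoiders_lr_le n tau p g m| * g <= #|avoiders_lr_le n.+1 tau p g.+1 m.+1| * m.+1)%N.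
Proof.
move=> tau0 pgn.
pose V := [set v : 'I_n | (p <= v < p + g)%N]%SET.
have cV : #|V| = g.
  have <- : #|[set: 'I_g]%SET| = g by rewrite cardsT card_ord.
  have vP (i : 'I_g) : (p + i < n)%N by have := ltn_ord i; lia.
  rewrite -(card_imset (f := fun i => Ordinal (vP i))); last first.
    by move=> i j [] /addnI ij; exact: val_inj.
  apply: eq_card => v; rewrite !inE; apply/idP/imsetP => [vp|[i _ ->]] /=.
    have ig : (v - p < g)%N by lia.
    by exists (Ordinal ig); [rewrite inE|apply: val_inj => /=; lia].
  have := ltn_ord i; lia.
rewrite -[X in (_ * X <= _)%N]cV -cardsX.
set A := avoiders_lr_le n tau p g m; set B := avoiders_lr_le n.+1 tau p g.+1 m.+1.
pose F (x : 'S_n * 'I_n) := (insert_max x.1 x.2, insert_pos x.1 x.2).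
pose Y := [set x : 'S_n.+1 * 'I_n.+1 | (x.1 \in B) && (x.2 \in lr_in x.1 p g.+1)]%SET.
(* The marked position reveals [v] as the entry there, and deleting that entry recovers [s]. *)
have Finj : injective F.
  move=> [s v] [t w] E; have /= E1 := congr1 fst E; have /= E2 := congr1 snd E.
  move: E1; rewrite /insert_max E2 => E1.
  have E3 : widen_ord (leqnSn n) v = widen_ord (leqnSn n) w.
    by have := congr1 (fun u : 'S_n.+1 => u (insert_pos t w)) E1; rewrite !lift_perm_id.
  have -> : v = w by apply: val_inj; exact: (congr1 val E3).
  congr pair; apply/permP => i.
  have := congr1 (fun u : 'S_n.+1 => u (lift (insert_pos t w) i)) E1.
  by rewrite !lift_perm_lift E3 => /lift_inj.
rewrite -(card_imset _ Finj); apply: (@leq_trans #|Y|).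
  apply/subset_leq_card/fintype.subsetP => _ /imsetP[[s v] + ->].
  rewrite !inE /= => /andP[/andP[sav sm] vp].
  rewrite lr_max_insert -andbA; apply/and3P; split.
  - by have := avoiders_insert tau s v tau0; rewrite !inE; exact.
  - exact: leq_trans (card_lr_in_insert _ _ _ _ vp) _.
  - by rewrite /insert_max lift_perm_id /=; lia.
(* Each permutation in [B] admits at most [m.+1] marks. *)
rewrite -sum1_card (eq_bigl (fun x => (x.1 \in B) && (x.2 \in lr_in x.1 p g.+1))); last first.
  by move=> x; rewrite inE.
rewrite -(pair_big_dep (mem B) (fun s i => i \in lr_in s p g.+1) (fun _ _ => 1%N)) /=.
rewrite -sum_nat_const; apply: leq_sum => s; rewrite sum1_card.
by rewrite inE => /andP[].
Qed.

Lemma avoiders_lr_le_iter {n k : nat} (tau : 'S_k.+1) (p g m j : nat) :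
  tau ord0 = ord_max -> (p + g <= n)%N ->
  (#|avoiders_lr_le n tau p g m| * \prod_(i < j) (g + i) <=
   #|avoiders_lr_le (n + j) tau p (g + j) (m + j)| * \prod_(i < j) (m + i).+1)%N.
Proof.
move=> tau0 pgn; elim: j => [|j IH].
  by rewrite !big_ord0 !addn0.
rewrite !big_ord_recr /= mulnA (leq_trans (leq_mul IH (leqnn _))) //.
rewrite mulnAC [X in (_ <= X)%N]mulnA [X in (_ <= X)%N]mulnAC leq_mul2r.
by rewrite !addnS avoiders_lr_le_step ?orbT //; lia.
Qed.

(** For [i < j], each quotient [(g + i) / (m + i).+1] is at least [g / (m + j)], hence at least
    [rho]. *)
Lemma card_avoiders_lr_le_exp (R : realType) {n k : nat} (tau : 'S_k.+1)
    (p g m j : nat) (rho : R) :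
  tau ord0 = ord_max -> (p + g <= n)%N -> 0 <= rho -> rho * (m + j)%:R <= g%:R ->
  #|avoiders_lr_le n tau p g m|%:R * rho ^+ j <= #|avoiders (n + j) tau|%:R.
Proof.
move=> tau0 pgn rho0 rhog.
have := avoiders_lr_le_iter tau p g m j tau0 pgn.
rewrite -(ler_nat R) !natrM !natr_prod => H.
have P0 : 0 < \prod_(i < j) (m + i).+1%:R :> R by apply: prodr_gt0.
rewrite -(ler_pM2r P0).
apply: le_trans (_ : #|avoiders_lr_le n tau p g m|%:R * \prod_(i < j) (g + i)%:R <= _).
  rewrite -mulrA ler_wpM2l // -[j in rho ^+ j]card_ord -prodr_const -big_split /=.
  apply: ler_prod => i _; rewrite mulr_ge0 //=.
  apply: (@le_trans _ _ (rho * (m + j)%:R)).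
    by rewrite ler_wpM2l // ler_nat; have := ltn_ord i; lia.
  by apply: le_trans rhog _; rewrite ler_nat; lia.
apply: le_trans H _; apply: ler_wpM2r; first exact: ltW.
rewrite ler_nat; apply: subset_leq_card.
by apply/fintype.subsetP => s; rewrite inE => /andP[].
Qed.

(** * Roots, limits and rounding *)

Lemma root_le_exp (R : realType) (x c : R) (n : nat) :
  (0 < n)%N -> 0 <= x -> 0 <= c -> (x `^ n%:R^-1 <= c) = (x <= c ^+ n).
Proof.
move=> n0 x0 c0; rewrite -(ler_pXn2r n0) ?nnegrE ?powR_ge0 //.
by rewrite -(powR_mulrn n (powR_ge0 _ _)) -powRrM mulVf ?powRr1 // pnatr_eq0 -lt0n.
Qed.

Lemma le_limn_esup (R : realType) (u : (\bar R)^nat) (c : \bar R) :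
  (\forall n \near \oo, (u n <= c)%E) -> (limn_esup u <= c)%E.
Proof.
move=> uc; rewrite /limn_esup limf_esupE.
apply: (@le_trans _ _ (ereal_sup [set u n | n in [set n | (u n <= c)%E]])).
  by apply: ereal_inf_lbound; exists [set n | (u n <= c)%E].
by apply: ge_ereal_sup => _ [n /= un <-].
Qed.

(* A divergent sequence has limit [point], which is [0] in [R]. *)
Lemma growth_rate_cvg (R : realType) {k : nat} (tau : 'S_k) : growth_rate R tau != 0 ->
  nth_root_card R (avoiders n tau) @[n --> \oo] --> growth_rate R tau.
Proof.
rewrite /growth_rate => L0.
have [//|/dvgP E] := pselect (cvg (nth_root_card R (avoiders n tau) @[n --> \oo])).
by rewrite E eqxx in L0.
Qed.

(** The left side carries the surplus [y ^+ (4 * q * j)], at least [y ^+ (2 * n)]: one factor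
    [y ^+ n] cancels the one on the right, the other remains as the gain. *)
Lemma le_exp_quotient (R : realType) (s L y : R) (n j q : nat) :
  0 <= s -> 0 < L -> 1 <= y -> (2 * n <= 4 * q * j)%N ->
  s * (L * y ^+ (4 * q).+1) ^+ j <= (L * y) ^+ (n + j) -> s <= (L / y) ^+ n.
Proof.
move=> s0 L0 y1 nqj; have y0 : 0 < y by apply: lt_le_trans y1.
have -> : (L * y ^+ (4 * q).+1) ^+ j =
    L ^+ j * y ^+ j * y ^+ n * (y ^+ n * y ^+ (4 * q * j - 2 * n)).
  rewrite exprMn -exprM -!mulrA -!exprD; congr (_ * _ ^+ _); lia.
have -> : (L * y) ^+ (n + j) = L ^+ n * (L ^+ j * y ^+ j * y ^+ n).
  by rewrite exprMn !exprD; ring.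
rewrite mulrCA mulrC ler_pM2r ?mulr_gt0 ?exprn_gt0 // => H.
rewrite expr_div_n ler_pdivlMr ?exprn_gt0 //; apply: le_trans H.
by rewrite mulrA ler_peMr ?exprn_ege1 // mulr_ge0 // exprn_ge0 // ltW.
Qed.

Lemma double_le_mul_divn (n q : nat) :
  (0 < q)%N -> (2 * q <= n)%N -> (2 * n <= 4 * q * (n %/ q))%N.
Proof.
move=> q0 qn; have := ltn_ceil n q0; rewrite mulSn -mulnA [(q * _)%N]mulnC.
lia.
Qed.

(** The zero-based values from [p] to [p + g - 1] are the entries from [p + 1] to [p + g], all
    inside [[a, b]]. *)
Lemma avoiders_lr_lt_sub (R : realType) {n k : nat} (tau : 'S_k) (a b t : R) (p g : nat) :
  0 <= t -> a <= p.+1%:R -> (p + g)%:R <= b ->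
  avoiders_lr_lt n tau `[a, b]%R t \subset avoiders_lr_le n tau p g (Num.truncn t).
Proof.
move=> t0 ap bpg; apply/fintype.subsetP => s; rewrite !inE => /andP[-> lrt] /=.
rewrite truncn_ge_nat //; apply/ltW/(le_lt_trans _ lrt).
rewrite ler_nat; apply/subset_leq_card/fintype.subsetP => i.
rewrite !inE => /andP[-> /andP[pi ig]] /=.
apply/andP; split.
  by apply: le_trans ap _; rewrite ler_nat.
by apply: le_trans bpg; rewrite ler_nat.
Qed.

(** * Choice of constants and conclusion *)

Theorem theorem2p6 (R : realType) (k : nat) (tau : 'S_k.+1)
    (htau : tau ord0 = ord_max)
    (alpha1 alpha2 : R)
    (halpha1 : 0 <= alpha1) (halpha12 : alpha1 < alpha2) (halpha2 : alpha2 <= 1)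
    (a b : nat -> R)
    (ha : a n / n%:R @[n --> \oo] --> alpha1)
    (hb : b n / n%:R @[n --> \oo] --> alpha2)
    (delta : R) (hdelta0 : 0 < delta)
    (hdelta : delta < (alpha2 - alpha1) / growth_rate R tau) :
  (limn_esup (fun n : nat =>
     (nth_root_card R (avoiders_lr_lt n tau `[a n, b n] (delta * n%:R)))%:E)
   < (growth_rate R tau)%:E)%E.
Proof.
(* Since the inverse of [0] is [0], a positive [delta] below the quotient forces a positive growth
   rate. *)
have L0 : 0 < growth_rate R tau.
  have := lt_trans hdelta0 hdelta.
  by rewrite pmulr_rgt0 ?subr_gt0 // invr_gt0.
have cvL := growth_rate_cvg R tau (lt0r_neq0 L0).
move: hdelta; set L := growth_rate R tau in L0 cvL * => hdelta.
have dL : delta * L < alpha2 - alpha1 by rewrite -ltr_pdivlMr.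
(* The window will have about [A * n] values, with [delta * L < A < alpha2 - alpha1]. The slack
   [4 * eta] pays for the convergence of both endpoints and for rounding. *)
pose A := (delta * L + (alpha2 - alpha1)) / 2.
pose eta := (alpha2 - alpha1 - A) / 4.
have eta0 : 0 < eta by rewrite /eta /A; lra.
have etaE : A = alpha2 - alpha1 - 4 * eta by rewrite /eta; lra.
pose rho := (L + A / delta) / 2.
have Lrho : L < rho.
  suff : L < A / delta by rewrite /rho; lra.
  by rewrite ltr_pdivlMr // mulrC /A; lra.
have rhoA : rho * delta < A.
  rewrite /rho mulrAC mulrDl divfK ?gt_eqF //.
  have : L * delta < A by rewrite mulrC /A; lra.
  lra.
(* Half of the slack in [rho * delta < A] absorbs [rho * j], which is what [q] is chosen for; the
   other half absorbs the rounding of [g]. *)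
pose kappa := (A - rho * delta) / 2.
have kappa0 : 0 < kappa by rewrite /kappa; lra.
have kappaE : A = rho * delta + 2 * kappa by rewrite /kappa; lra.
pose q := (Num.truncn (rho / kappa)).+1.
have rhoq : rho < kappa * q%:R by rewrite mulrC -ltr_pdivrMr // truncnS_gt.
have rho0 : 0 < rho by apply: lt_trans Lrho.
(* This root gives [rho] the shape required by [le_exp_quotient]; the limsup will be at most
   [L / y]. *)
pose y := (rho / L) `^ (4 * q).+1%:R^-1.
have yrho : rho = L * y ^+ (4 * q).+1.
  rewrite -(powR_mulrn _ (powR_ge0 _ _)) -powRrM mulVf ?pnatr_eq0 // powRr1; last first.
    by rewrite divr_ge0 // ltW.
  by rewrite mulrCA divff ?mulr1 // gt_eqF.
have y1 : 1 < y.
  rewrite ltNge root_le_exp ?expr1n ?ler01 //; last by rewrite divr_ge0 // ltW.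
  by rewrite -ltNge ltr_pdivlMr // mul1r.
have y0 : 0 < y by apply: lt_trans y1.
apply: (@le_lt_trans _ _ (L / y)%:E); last first.
  by rewrite lte_fin ltr_pdivrMr // ltr_pMr.
have A0 : 0 < A by apply: lt_trans rhoA; rewrite mulr_gt0.
have q0 : (0 < q)%N by [].
clearbody L A eta rho kappa q y.
have LLy : L < L * y by rewrite ltr_pMr.
have [N _ HN] := cvgr_le _ cvL _ LLy.
apply: le_limn_esup.
have /(cvgr_le _ ha) ha' : alpha1 < alpha1 + eta by rewrite ltrDl.
have /(cvgr_ge _ hb) hb' : alpha2 - eta < alpha2 by rewrite ltrBlDr ltrDl.
near=> n.
have n0 : (0 < n)%N by near: n; exact: nbhs_infty_ge.
have n0R : 0 < n%:R :> R by rewrite ltr0n.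
have han : a n <= (alpha1 + eta) * n%:R.
  by rewrite -ler_pdivrMr //; near: n.
have hbn : (alpha2 - eta) * n%:R <= b n.
  by rewrite -ler_pdivlMr //; near: n.
have etan : 1 <= eta * n%:R.
  by rewrite mulrC -ler_pdivrMr //; near: n; exact: nbhs_infty_ger.
have kappan : 1 <= kappa * n%:R.
  by rewrite mulrC -ler_pdivrMr //; near: n; exact: nbhs_infty_ger.
have nN : (N <= n)%N by near: n; exact: nbhs_infty_ge.
have nq : (2 * q <= n)%N by near: n; exact: nbhs_infty_ge.
rewrite lee_fin root_le_exp //; last by rewrite divr_ge0 // ltW.
pose p := (Num.truncn ((alpha1 + eta) * n%:R)).+1.
pose g := Num.truncn (A * n%:R).
pose m := Num.truncn (delta * n%:R).
pose j := (n %/ q)%N.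
have truncP (x : R) : 0 <= x -> (Num.truncn x)%:R <= x /\ x < (Num.truncn x)%:R + 1.
  by move=> /truncn_itv/andP[? ?]; rewrite natr1.
have [|p1 p2] := truncP ((alpha1 + eta) * n%:R).
  by rewrite mulr_ge0 // addr_ge0 // ltW.
have [|g1 g2] := truncP (A * n%:R); first by rewrite mulr_ge0 // ltW.
have [|m1 _] := truncP (delta * n%:R); first by rewrite mulr_ge0 // ltW.
have pg : (p + g)%:R <= (alpha2 - eta) * n%:R.
  rewrite natrD /p -natr1 -/g.
  have : A * n%:R = (alpha2 - alpha1 - 4 * eta) * n%:R by rewrite etaE.
  lra.
apply: (@le_trans _ _ #|avoiders_lr_le n tau p g m|%:R).
  rewrite ler_nat subset_leq_card // avoiders_lr_lt_sub //.
  - by rewrite mulr_ge0 // ltW.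
  - by apply: le_trans han _; rewrite /p -natr1; lra.
  - exact: le_trans hbn.
apply: (@le_exp_quotient _ _ _ _ _ j q) => //; first exact: ltW.
  exact: double_le_mul_divn.
rewrite -yrho.
apply: le_trans (_ : #|avoiders (n + j) tau|%:R <= _).
  apply: card_avoiders_lr_le_exp => //; last 1 first.
  (* In total, [rho * (m + j)] is at most [(rho * delta + kappa) * n = A * n - kappa * n], hence at
     most [A * n - 1 < g]. *)
  - have jq : j%:R * q%:R <= n%:R :> R by rewrite -natrM ler_nat leq_trunc_div.
    have : rho * j%:R <= kappa * n%:R.
      apply: (@le_trans _ _ (kappa * q%:R * j%:R)); first by rewrite ler_wpM2r // ltW.
      by rewrite -mulrA ler_pM2l // mulrC.
    have : rho * m%:R <= rho * delta * n%:R by rewrite -mulrA ler_pM2l.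
    have : A * n%:R = rho * delta * n%:R + 2 * kappa * n%:R.
      by rewrite -mulrDl kappaE.
    by rewrite natrD mulrDr; move: g2; rewrite -/g; lra.
  - rewrite -(ler_nat R); apply: le_trans pg _.
    rewrite -[leRHS]mul1r ler_pM2r //; lra.
  - exact: ltW.
(* The bound [L * y] on the roots holds from [N] on, in particular at length [n + j]. *)
have nj0 : (0 < n + j)%N by rewrite addn_gt0 n0.
rewrite -root_le_exp //; last by rewrite mulr_ge0 // ltW.
by apply: (HN (n + j)%N) => /=; rewrite (leq_trans nN) // leq_addr.
Unshelve. all: by end_near.
Qed.
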